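(* Let $(\mathcal{T}_r)_{r\in\mathbb{Z}}$ be a sequence of complex numbers satisfying $\mathcal{T}_r=\mathcal{T}_{r-1}+\mathcal{T}_{r-2}+\mathcal{T}_{r-3}$ for all integers $r$. Then for every integer $r$: \[ \begin{aligned} &\mathcal{T}_r^3 - 4\mathcal{T}_{r-1}^3 - 9\mathcal{T}_{r-2}^3 - 34\mathcal{T}_{r-3}^3 + 24\mathcal{T}_{r-4}^3 - 2\mathcal{T}_{r-5}^3\\ &\quad + 40\mathcal{T}_{r-6}^3 - 14\mathcal{T}_{r-7}^3 - \mathcal{T}_{r-8}^3 - 2\mathcal{T}_{r-9}^3 + \mathcal{T}_{r-10}^3 = 0 . \end{aligned} \]
   Context: A generalized Tribonacci sequence is determined by arbitrary initial values $\mathcal{T}_0,\mathcal{T}_1,\mathcal{T}_2$ and the recurrence $\mathcal{T}_r=\mathcal{T}_{r-1}+\mathcal{T}_{r-2}+\mathcal{T}_{r-3}$, extended to all integer indices. *)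

(* Defs.v *)
From Stdlib Require Export ZArith Reals.
From Coquelicot Require Export Coquelicot.

Definition generalized_tribonacci (T : Z -> C) : Prop :=
  forall r : Z, T r = (T (r - 1)%Z + T (r - 2)%Z + T (r - 3)%Z)%C.

(* Main.v *)
Require Import Defs.
From Stdlib Require Import Lia.
Local Open Scope C_scope.

(** The recurrence makes all eleven terms linear forms in the three oldest. Their cubes lie in the
    10-dimensional space of ternary cubic forms, so some linear relation is forced; expansion
    confirms these coefficients. *)

Lemma tribonacci_shift (T : Z -> C) (hT : generalized_tribonacci T) (s r : Z) :
  T (r - s)%Z = T (r - (s + 1))%Z + T (r - (s + 2))%Z + T (r - (s + 3))%Z.
Proof.
  rewrite (hT (r - s)%Z).
  replace (r - s - 1)%Z with (r - (s + 1))%Z by lia.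
  replace (r - s - 2)%Z with (r - (s + 2))%Z by lia.
  replace (r - s - 3)%Z with (r - (s + 3))%Z by lia.
  reflexivity.
Qed.

(* The identity is polynomial in the three oldest terms; it is checked on real
   and imaginary parts because the [C] ring does not read the [RtoC] constants. *)
Theorem theorem4 (T : Z -> C) (hT : generalized_tribonacci T) (r : Z) :
  T r ^ 3 - 4%R * T (r - 1)%Z ^ 3 - 9%R * T (r - 2)%Z ^ 3
  - 34%R * T (r - 3)%Z ^ 3 + 24%R * T (r - 4)%Z ^ 3 - 2%R * T (r - 5)%Z ^ 3
  + 40%R * T (r - 6)%Z ^ 3 - 14%R * T (r - 7)%Z ^ 3 - T (r - 8)%Z ^ 3
  - 2%R * T (r - 9)%Z ^ 3 + T (r - 10)%Z ^ 3 = 0%R.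
Proof.
  rewrite (hT r).
  (* Newest to oldest: each rewrite removes one offset for good, and [simpl Z.add] restores literal
     offsets for the next match. *)
  rewrite (tribonacci_shift T hT 1); simpl Z.add.
  rewrite (tribonacci_shift T hT 2); simpl Z.add.
  rewrite (tribonacci_shift T hT 3); simpl Z.add.
  rewrite (tribonacci_shift T hT 4); simpl Z.add.
  rewrite (tribonacci_shift T hT 5); simpl Z.add.
  rewrite (tribonacci_shift T hT 6); simpl Z.add.
  rewrite (tribonacci_shift T hT 7); simpl Z.add.
  destruct (T (r - 8)%Z) as [a a'], (T (r - 9)%Z) as [b b'],
    (T (r - 10)%Z) as [c c'].
  apply injective_projections; simpl; ring.
Qed.
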